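(* Let $U,\Sigma,H_1,H_2$ be Hilbert spaces, $\mathbf V=U\times\Sigma$, $\mathbf H=H_1\times H_2$, let $L_1:U\times\Sigma\to H_1$, $L_2:U\times\Sigma\to H_2$ be linear, $K:U\to H_2$ a map, and set $\mathcal R(u,\sigma)=(L_1(u,\sigma),\,L_2(u,\sigma)+K(u))$ and $\boldsymbol f=(f,g)\in\mathbf H$. Assume: (A1) there exist positive constants $C_1,\dots,C_6$ such that for all $(u,\sigma)\in U\times\Sigma$ $$C_1\|u\|_U^2+C_2\|\sigma\|_\Sigma^2\le \|L_1(u,\sigma)\|_{H_1}^2+\|L_2(u,\sigma)\|_{H_2}^2,$$ $$\|L_1(u,\sigma)\|_{H_1}^2\le C_3\|u\|_U^2+C_4\|\sigma\|_\Sigma^2,\qquad \|L_2(u,\sigma)\|_{H_2}^2\le C_5\|u\|_U^2+C_6\|\sigma\|_\Sigma^2;$$ (A2) there exist an open non-empty set $S\subset U$ and a constant $L$ with $0<L<C_1$ such that $\|K(u)-K(v)\|_{H_2}^2\le L\,\|u-v\|_U^2$ for all $u,v\in S$. Let $K$ be Fréchet differentiable in $S$ and let $\boldsymbol u^*=(u^*,\sigma^* )\in S\times\Sigma$ be a solution of $\mathcal R(\boldsymbol u)+\boldsymbol f=\boldsymbol 0$. Assume that the AFEM-loop (described in the context) converges, i.e. terminates and returns a direction $\delta\boldsymbol u_n$ satisfying its stopping criterion. Then there exists $\varepsilon>0$ such that for any initial guess $\boldsymbol u_0\in B(\boldsymbol u^*,\varepsilon)$: (a) the inexact Newton method (inexact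 Gauss-Newton algorithm, described in the context) is well-defined and generates a sequence $(\boldsymbol u_n)$ which converges to $\boldsymbol u^*$; (b) $\boldsymbol u^*$ is the unique solution of $\mathcal R(\boldsymbol u)+\boldsymbol f=\boldsymbol 0$ in $B(\boldsymbol u^*,\varepsilon)$; (c) the sequence $(\boldsymbol u_n)$ generated by the inexact Gauss-Newton algorithm converges superlinearly; (d) if additionally $K'$ is Lipschitz continuous on $B(\boldsymbol u^*,\varepsilon)$, then $(\boldsymbol u_n)$ converges quadratically.
   Context: $B(\boldsymbol u^*,\varepsilon)$ is the ball of radius $\varepsilon$ about $\boldsymbol u^*$ in $\mathbf V$; $\mathcal R'$ and $K'$ denote Fréchet derivatives. $K'$ being Lipschitz on $B(\boldsymbol u^*,\varepsilon)$ refers to the dependence on the $U$-component. The spaces are function spaces on a domain $\Omega$; $\mathcal T$ denotes a triangulation of $\Omega$ and $\mathbf V_{\mathcal T}\subset\mathbf V$ an associated finite-dimensional (finite element) subspace. Inexact Gauss-Newton algorithm: given $\boldsymbol u_0$, $\tau\in(0,1)$ and a marking parameter $\theta\in(0,1)$, set $\eta_0=\tau$. For $n=0,1,2,\dots$: determine a Newton direction $\delta\boldsymbol u_n$ by the AFEM-loop with forcing parameter $\eta_n$; set $\boldsymbol u_{n+1}=\boldsymbol u_n+\delta\boldsymbol u_n$ and $\eta_{n+1}=\min\{\tau\eta_n,\ \|\mathcal R(\boldsymbol u_{n+1})+\boldsymbol f\|_{\mathbf H}\}$. AFEM-loop (given $\boldsymbol u_n,\eta_n$ and a current mesh $\mathcal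 T$): repeat the following. (i) Determine $\delta\boldsymbol u_n$ by (inexactly) minimizing $\|\mathcal R'(\boldsymbol u_n)\boldsymbol v+\boldsymbol f+\mathcal R(\boldsymbol u_n)\|_{\mathbf H}^2$ over $\boldsymbol v\in\mathbf V_{\mathcal T}$. (ii) If $\|\mathcal R'(\boldsymbol u_n)\delta\boldsymbol u_n+\boldsymbol f+\mathcal R(\boldsymbol u_n)\|_{\mathbf H}\le\eta_n\,\|\mathcal R(\boldsymbol u_n)+\boldsymbol f\|_{\mathbf H}$, stop and return $\delta\boldsymbol u_n$. (iii) Otherwise compute for each element $T\in\mathcal T$ the local contribution $\mu_n(T)$ of $T$ to $\|\mathcal R'(\boldsymbol u_n)\delta\boldsymbol u_n+\boldsymbol f+\mathcal R(\boldsymbol u_n)\|_{\mathbf H}^2$, mark a minimal set $\mathcal M\subset\mathcal T$ with $\sum_{T\in\mathcal M}\mu_n(T)\ge\theta\sum_{T\in\mathcal T}\mu_n(T)$, refine all marked elements, and take the resulting mesh as the new $\mathcal T$.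
   Formalization: It is additionally assumed that K' is continuous at u* in the operator norm; with mere Fréchet differentiability in S the claim fails, e.g. K(u) = (3/4)u² sin(1/u) on the real line gives Newton 2-cycles arbitrarily close to u* = 0. *)

(* Defs.v *)
From HB Require Import structures.
From mathcomp Require Import all_boot all_order all_algebra.
From mathcomp Require Import all_classical all_reals all_analysis.

Set Implicit Arguments.
Unset Strict Implicit.
Unset Printing Implicit Defensive.

Import Order.TTheory GRing.Theory Num.Theory.
Import numFieldNormedType.Exports.

Local Open Scope classical_set_scope.
Local Open Scope ring_scope.

(* The norm of a complete real normed space comes from an inner product. *)
Definition is_hilbert (R : realType) (X : completeNormedModType R) : Prop :=
  exists ip : X -> X -> R,
    [/\ forall x y, ip x y = ip y x,
        forall a x y z, ip (a *: x + y) z = a * ip x z + ip y z &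
        forall x, `|x| ^+ 2 = ip x x].

(* Hilbert norm of a product. The library norms [X * Y] with the maximum of the
   two norms; this is an equivalent norm, so that limits, differentiability and
   Frechet derivatives on [X * Y] are the same for both. *)
Definition hnorm (R : realType) (X Y : normedModType R) (x : X * Y) : R :=
  Num.sqrt (`|x.1| ^+ 2 + `|x.2| ^+ 2).

Definition hball (R : realType) (X Y : normedModType R) (x : X * Y) (e : R) :
    set (X * Y) :=
  [set y | hnorm (y - x) < e].

Definition calR (R : realType) (U Sg H1 H2 : normedModType R)
    (L1 : {linear (U * Sg)%type -> H1}) (L2 : {linear (U * Sg)%type -> H2})
    (K : U -> H2) (u : U * Sg) : H1 * H2 :=
  (L1 u, L2 u + K u.1).

(* Meshes of a domain Omega with a finite element space attached to each of
   them. Only the features used by an adaptive loop are recorded. *)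
Record fe_setting (R : realType) (d : nat) (Omega : set 'rV[R]_d)
    (U Sg H1 H2 : normedModType R) := FESetting {
  mesh : Type;
  elem : mesh -> finType;
  cell : forall T, elem T -> set 'rV[R]_d;
  (* up to boundaries: the cells may be taken open or closed *)
  cell_cover : forall T, closure (\bigcup_t cell (T := T) t) = closure Omega;
  cell_disjoint : forall T (s t : elem T),
    s != t -> (cell s)° `&` (cell t)° = set0;
  fdim : mesh -> nat;
  fbasis : forall T, 'I_(fdim T) -> U * Sg;
  (* [contrib T r t] is the part of [hnorm r ^+ 2] that lives on [t] *)
  contrib : forall T, H1 * H2 -> elem T -> R;
  contrib_ge0 : forall T r (t : elem T), 0 <= contrib r t;
  contrib_sum : forall T r, \sum_(t : elem T) contrib r t = hnorm r ^+ 2;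
  refine : forall T, {set elem T} -> mesh;
  refine_sub : forall T (M : {set elem T}) (t' : elem (refine M)),
    exists t : elem T, cell t' `<=` cell t;
  refine_marked : forall T (M : {set elem T}) (t : elem T), t \in M ->
    forall t' : elem (refine M), cell t' <> cell t
}.

Definition fespace (R : realType) (d : nat) (Omega : set 'rV[R]_d)
    (U Sg H1 H2 : normedModType R) (F : fe_setting Omega U Sg H1 H2)
    (T : mesh F) : set (U * Sg) :=
  [set v | exists c : 'I_(fdim T) -> R, v = \sum_i c i *: fbasis i].

Section GaussNewton.
Context {R : realType} {U Sg H1 H2 : normedModType R}.
Variables (G : U * Sg -> H1 * H2) (b : H1 * H2).

(* The residual at [u] linearized in the direction [v]. *)
Definition lin_residual (u v : U * Sg) : H1 * H2 := 'd G u v + b + G u.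

Definition accepted (u : U * Sg) (eta : R) (v : U * Sg) : Prop :=
  hnorm (lin_residual u v) <= eta * hnorm (G u + b).

Variables (d : nat) (Omega : set 'rV[R]_d).
Variables (F : fe_setting Omega U Sg H1 H2) (theta : R).

(* The two steps of the loop that leave a choice: the inexact least-squares
   solver, whose accuracy [tol] is arbitrary (it is exact for [tol = 0]), and
   the selection of a minimal marked set. *)
Record afem_choices := AfemChoices {
  tol : U * Sg -> R -> mesh F -> R;
  solve : U * Sg -> R -> mesh F -> U * Sg;
  solve_fespace : forall u eta T, fespace T (solve u eta T);
  solve_min : forall u eta T w, fespace T w ->
    hnorm (lin_residual u (solve u eta T)) ^+ 2 <=
    hnorm (lin_residual u w) ^+ 2 + tol u eta T;
  mark : forall T : mesh F, (elem T -> R) -> {set elem T};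
  mark_min : forall (T : mesh F) (mu : elem T -> R), (forall t, 0 <= mu t) ->
    minset [pred M : {set elem T} |
             theta * \sum_t mu t <= \sum_(t in M) mu t] (mark mu)
}.

Variable A : afem_choices.

(* [afem_loop u eta T du T']: started on the mesh [T], the loop terminates,
   with direction [du] and final mesh [T']. *)
Inductive afem_loop (u : U * Sg) (eta : R) :
    mesh F -> U * Sg -> mesh F -> Prop :=
| AfemStop T : accepted u eta (solve A u eta T) ->
    afem_loop u eta T (solve A u eta T) T
| AfemRefine T du T' : ~ accepted u eta (solve A u eta T) ->
    afem_loop u eta
      (refine (mark A (contrib (T := T) (lin_residual u (solve A u eta T)))))
      du T' ->
    afem_loop u eta T du T'.

Variables (tau : R) (T0 : mesh F).

Definition next_eta (eta : R) (u : U * Sg) : R :=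
  Num.min (tau * eta) (hnorm (G u + b)).

(* The triples (iterate, forcing parameter, current mesh) with which the
   Gauss-Newton algorithm started at [u0] calls the loop. *)
Inductive gn_call (u0 : U * Sg) : U * Sg -> R -> mesh F -> Prop :=
| GNStart : gn_call u0 u0 tau T0
| GNNext u eta T du T' : gn_call u0 u eta T -> afem_loop u eta T du T' ->
    gn_call u0 (u + du) (next_eta eta (u + du)) T'.

(* Convergence of the AFEM-loop, for all its calls by the algorithm at points
   of [D]; the returned direction is accepted by construction. *)
Definition afem_converges (D : set (U * Sg)) : Prop :=
  forall u0, D u0 -> forall u eta T, gn_call u0 u eta T -> D u ->
  exists du T', afem_loop u eta T du T'.

Definition gn_sequence (u0 : U * Sg) (u : nat -> U * Sg) : Prop :=
  exists (eta : nat -> R) (T : nat -> mesh F) (du : nat -> U * Sg),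
    [/\ u 0%N = u0, eta 0%N = tau, T 0%N = T0 &
        forall n, [/\ afem_loop (u n) (eta n) (T n) (du n) (T n.+1),
                      u n.+1 = u n + du n &
                      eta n.+1 = next_eta (eta n) (u n.+1)]].

End GaussNewton.

Section Rates.
Context {R : realType} {X Y : normedModType R}.
Variables (u : nat -> X * Y) (l : X * Y).

Let err (n : nat) : R^o := hnorm (u n - l).

Definition superlinear_cvg : Prop :=
  u @ \oo --> l /\ (fun n => err n.+1) =o_\oo err.

Definition quadratic_cvg : Prop :=
  u @ \oo --> l /\ (fun n => err n.+1) =O_\oo (fun n => err n ^+ 2 : R^o).

End Rates.

(* The derivative of K is continuous at u (in the operator norm). *)
Definition diff_continuous_at (R : realType) (X Y : normedModType R)
    (K : X -> Y) (u : X) : Prop :=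
  forall e : R, 0 < e ->
    \forall v \near u, forall h, `|'d K v h - 'd K u h| <= e * `|h|.

(* The derivative of K is Lipschitz in the first component on the set B. *)
Definition diff_lipschitz_on (R : realType) (X Y Z : normedModType R)
    (K : X -> Z) (B : set (X * Y)) : Prop :=
  exists k : R, forall u v, B u -> B v ->
    forall h, `|'d K (u.1) h - 'd K (v.1) h| <= k * `|u.1 - v.1| * `|h|.

(* Main.v *)
From HB Require Import structures.
Require Import Defs.
From mathcomp Require Import all_boot all_order all_algebra.
From mathcomp Require Import all_classical all_reals all_analysis.
From mathcomp Require Import ring lra.

Set Implicit Arguments.
Unset Strict Implicit.
Unset Printing Implicit Defensive.

Import Order.TTheory GRing.Theory Num.Theory.
Import numFieldNormedType.Exports.

Local Open Scope classical_set_scope.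
Local Open Scope ring_scope.

(** Write [G] for the nonlinear operator, [e] for the error [u - ustar] and
[delta] for a direction accepted by the adaptive loop with forcing parameter
[eta].

_Stability._ Since [L < C1], a perturbation [k] of the second component with
[`|k| ^+ 2 <= L * `|x.1| ^+ 2] absorbs only a fixed fraction of the lower bound
for [(L1 x, L2 x)]. Hence the norm of [(L1 x, L2 x + k)] lies between
[c * hnorm x] and [M * hnorm x] with [0 < c] ([stability_bounds]). Differences
[G u - G v] and derivatives of [G] both have this form, so that residuals and
linearized residuals are equivalent to errors. Uniqueness of the solution is a
first consequence.

_One step._ The linearized residual of [delta] is the derivative of [G] at [u]
applied to the new error [e + delta], plus the defect
[K u - K ustar - K'(u) (u - ustar)] ([lin_residualE]). As it is at most [eta]
times the residual, stability gives
[c * hnorm (e + delta) <= (eta * M + kappa) * hnorm e] whenever the defect is at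
most [kappa * hnorm e] ([error_step]). By differentiability of [K] and
continuity of [K'] at [ustar], [kappa] is as small as desired near [ustar].

_Convergence._ The bound just given need not be a contraction, because [eta]
may be close to 1 while [M / c] is large. In the equivalent norm
[hnorm (G'(ustar) e)], called the energy, the factors [M] and [c] only multiply
[kappa], and the step contracts by [(1 + tau) / 2] once [kappa] is small
([energy_step]). Energy balls are therefore preserved, the algorithm never
leaves the region where it is defined, and its iterates converge.

_Rates._ Superlinear convergence follows from [error_step], as [eta] and
[kappa] tend to 0. If [K'] is Lipschitz, the mean value inequality allows
[kappa] to be a multiple of [hnorm e] ([defect_quadratic]), and from the second
step on [eta] is at most the current residual, hence at most [M * hnorm e]; the
step is then quadratic. *)

(** * The Hilbert norm of a product *)

Section HilbertNormOfProduct.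
Context {R : realType} {X Y : normedModType R}.
Implicit Types x y : X * Y.

Lemma hnorm_ge0 x : 0 <= hnorm x. Proof. exact: sqrtr_ge0. Qed.

Lemma sqr_hnorm x : hnorm x ^+ 2 = `|x.1| ^+ 2 + `|x.2| ^+ 2.
Proof. by rewrite sqr_sqrtr// addr_ge0 ?sqr_ge0. Qed.

Lemma hnorm_le x a :
  0 <= a -> `|x.1| ^+ 2 + `|x.2| ^+ 2 <= a ^+ 2 -> hnorm x <= a.
Proof. by move=> a0 h; rewrite -ler_sqr ?nnegrE ?hnorm_ge0// sqr_hnorm. Qed.

Lemma hnorm_ge x a : a ^+ 2 <= `|x.1| ^+ 2 + `|x.2| ^+ 2 -> a <= hnorm x.
Proof.
move=> h; case: (lerP a 0) => [/le_trans|a0]; first by apply; exact: hnorm_ge0.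
by rewrite -ler_sqr ?nnegrE ?hnorm_ge0 ?(ltW a0)// sqr_hnorm.
Qed.

Lemma norm_fst_hnorm x : `|x.1| <= hnorm x.
Proof. by apply: hnorm_ge; rewrite lerDl sqr_ge0. Qed.

Lemma norm_snd_hnorm x : `|x.2| <= hnorm x.
Proof. by apply: hnorm_ge; rewrite lerDr sqr_ge0. Qed.

Lemma hnormN x : hnorm (- x) = hnorm x.
Proof. by rewrite /hnorm/= !normrN. Qed.

Lemma hnorm0 : hnorm (0 : X * Y) = 0.
Proof. by rewrite /hnorm/= !normr0 expr0n addr0 sqrtr0. Qed.

Lemma hnorm_inr (y : Y) : hnorm ((0, y) : X * Y) = `|y|.
Proof. by rewrite /hnorm/= normr0 expr0n add0r sqrtr_sqr normr_id. Qed.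

Lemma hnorm0_eq0 x : hnorm x <= 0 -> x = 0.
Proof.
move=> h; case: x h => a b h.
have := le_trans (norm_fst_hnorm _) h; have := le_trans (norm_snd_hnorm _) h.
by rewrite !normr_le0/= => /eqP-> /eqP->.
Qed.

(** Minkowski's inequality in the plane, from the Cauchy-Schwarz inequality for
the pairs of component norms. *)
Lemma ler_hnormD x y : hnorm (x + y) <= hnorm x + hnorm y.
Proof.
have hx := hnorm_ge0 x; have hy := hnorm_ge0 y.
apply: hnorm_le; first exact: addr_ge0.
have ex := sqr_hnorm x; have ey := sqr_hnorm y.
set a := `|x.1| in ex *; set b := `|x.2| in ex *.
set a' := `|y.1| in ey *; set b' := `|y.2| in ey *.
have cs : a * a' + b * b' <= hnorm x * hnorm y.
  rewrite -ler_sqr ?nnegrE ?addr_ge0 ?mulr_ge0 /a /a' /b /b'//.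
  rewrite exprMn ex ey -subr_ge0.
  have -> : (a ^+ 2 + b ^+ 2) * (a' ^+ 2 + b' ^+ 2) - (a * a' + b * b') ^+ 2
    = (a * b' - b * a') ^+ 2 by ring.
  exact: sqr_ge0.
have h1 : `|(x + y).1| ^+ 2 <= (a + a') ^+ 2.
  by rewrite ler_sqr ?nnegrE ?addr_ge0 /a /a'//= ler_normD.
have h2 : `|(x + y).2| ^+ 2 <= (b + b') ^+ 2.
  by rewrite ler_sqr ?nnegrE ?addr_ge0 /b /b'//= ler_normD.
apply: le_trans (lerD h1 h2) _; nra.
Qed.

Lemma ler_hnormB x y : hnorm (x - y) <= hnorm x + hnorm y.
Proof. by rewrite -(hnormN y) ler_hnormD. Qed.

Lemma hnorm_inrD x (y : Y) : hnorm (x + (0, y)) <= hnorm x + `|y|.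
Proof. by rewrite -(hnorm_inr y) ler_hnormD. Qed.

Lemma hnorm_le_inrD x (y : Y) : hnorm x <= hnorm (x + (0, y)) + `|y|.
Proof. by rewrite -(hnorm_inr y) (le_trans _ (ler_hnormB _ _))// addrK. Qed.

Lemma hnorm_le_norm x : hnorm x <= 2 * `|x|.
Proof.
have h1 : `|x.1| <= `|x| by rewrite prod_normE le_max lexx.
have h2 : `|x.2| <= `|x| by rewrite prod_normE le_max lexx orbT.
apply: hnorm_le; first by rewrite mulr_ge0.
have := normr_ge0 x.1; have := normr_ge0 x.2; nra.
Qed.

(** The topology of [X * Y] is that of the maximum norm, whereas all error
estimates are in the equivalent Hilbert norm. *)
Lemma cvg_hnormP (u : nat -> X * Y) (l : X * Y) :
  (u @ \oo --> l) <-> ((fun n => hnorm (u n - l)) @ \oo --> (0 : R)).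
Proof.
split=> [ul|hl].
- have cfst : (fun n => `|(u n).1 - l.1|) @ \oo --> (0 : R).
    apply/cvgr0Pnorm_lt => e e0; move/cvgrPdist_lt: ul => /(_ e e0).
    apply: filterS => n /=; rewrite normr_id distrC prod_normE.
    by rewrite gt_max => /andP[].
  have csnd : (fun n => `|(u n).2 - l.2|) @ \oo --> (0 : R).
    apply/cvgr0Pnorm_lt => e e0; move/cvgrPdist_lt: ul => /(_ e e0).
    apply: filterS => n /=; rewrite normr_id distrC prod_normE.
    by rewrite gt_max => /andP[].
  apply: (squeeze_cvgr _ (cvg_cst 0)); last first.
    rewrite -[X in _ --> X](addr0 0); exact: (cvgD cfst csnd).
  near=> n; rewrite hnorm_ge0/=; apply: hnorm_le; first exact: addr_ge0.
  rewrite /= sqrrD lerD2r lerDl mulrn_wge0// mulr_ge0//.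
- apply/cvgrPdist_lt => e e0; move/cvgr0Pnorm_lt: hl => /(_ e e0).
  apply: filterS => n; rewrite ger0_norm ?hnorm_ge0// => h.
  rewrite distrC prod_normE gt_max.
  by rewrite (le_lt_trans (norm_fst_hnorm _) h)
    (le_lt_trans (norm_snd_hnorm _) h).
Unshelve. all: by end_near. Qed.

End HilbertNormOfProduct.

(** * Linear maps and differentials *)

Section Differentials.
Context {R : realType} {X Y : normedModType R}.
Implicit Types f : X -> Y.

Lemma linear_norm_le_continuous (f : {linear X -> Y}) (k : R) :
  (forall x, `|f x| <= k * `|x|) -> continuous f.
Proof.
move=> fk; apply/linear_bounded_continuous; rewrite /bounded_near; near=> N.
apply/nbhs_normP; exists 1 => //= x /=; rewrite sub0r normrN => x1 /=.
apply: (@le_trans _ _ `|k|); last by near: N; exact: nbhs_pinfty_ge.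
apply: le_trans (fk x) _; apply: le_trans (ler_norm _) _.
by rewrite normrM normr_id ler_piMr// ltW.
Unshelve. all: by end_near. Qed.

Lemma near_diff_approx f x : differentiable f x -> forall e : R, 0 < e ->
  \forall y \near x, `|f y - f x - 'd f x (y - x)| <= e * `|y - x|.
Proof.
move=> /diff_locally/eqaddoP fx e e0; have {fx} := fx _ e0.
move=> /nbhs_normP[r /= r0 fx]; apply/nbhs_normP; exists r => //= y xy.
have := fx (y - x); rewrite /= sub0r normrN distrC => /(_ xy).
rewrite -[X in `|X|]/(f (y - x + x) - (f x + 'd f x (y - x))).
by rewrite subrK opprD addrA.
Qed.

(** Along a ray from [x], the increment of [f] is at most [l] times the step and
differs from the differential by an arbitrarily small multiple of the step;
homogeneity of the differential then removes the step. *)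
Lemma differential_lipschitz_le f x (l : R) : differentiable f x ->
  (\forall y \near x, `|f y - f x| <= l * `|y - x|) ->
  forall h, `|'d f x h| <= l * `|h|.
Proof.
move=> df flip h; apply/ler_addgt0Pr => e e0.
case: (eqVneq h 0) => [->|h0].
  by rewrite linear0 !normr0 mulr0 add0r ltW.
have hp : 0 < `|h| by rewrite normr_gt0.
have /(near_diff_approx df) : 0 < e / `|h| by rewrite divr_gt0.
move=> /(filterI flip)/nbhs_normP[r /= r0 fr].
(* The half of [r] keeps [x + t *: h] inside the open ball. *)
pose t := r / 2 / `|h|; have t0 : 0 < t by rewrite !divr_gt0.
have [] := fr (x + t *: h).
  rewrite /= opprD addNKr normrN normrZ gtr0_norm// /t divfK ?gt_eqF//.
  by rewrite gtr_pMr// invf_lt1// ltr1n.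
have -> : x + t *: h - x = t *: h by rewrite addrC addKr.
rewrite linearZ/= normrZ gtr0_norm// => h1 h2.
have : t * `|'d f x h| <= l * (t * `|h|) + e / `|h| * (t * `|h|).
  rewrite -{1}(gtr0_norm t0) -normrZ.
  by apply: le_trans (lerD h1 h2); rewrite -{1}(subKr (f (x + t *: h) - f x)
    (t *: 'd f x h)) ler_normB.
have -> : l * (t * `|h|) + e / `|h| * (t * `|h|) = t * (l * `|h| + e).
  by rewrite mulrDr; congr (_ + _); [ring | field; rewrite gt_eqF].
by rewrite ler_pM2l.
Qed.

End Differentials.

(** * The mean value inequality in a Hilbert space *)

Section HilbertMeanValue.
Context {R : realType}.

(** The inner product with [y]; it reduces statements about vectors to
statements about real functions, as it attains [`|y| ^+ 2] at [y]. *)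
Lemma hilbert_functional (Y : completeNormedModType R) (y : Y) :
  is_hilbert Y -> exists ell : {linear Y -> R^o},
    [/\ continuous ell, ell y = `|y| ^+ 2 & forall x, ell x <= `|x| * `|y|].
Proof.
case=> ip [ipC ipL ipE].
have ipl : linear (fun x => ip x y : R^o) by move=> a u v; rewrite ipL.
have ip0 z : ip 0 z = 0.
  have := ipL 1 0 0 z; rewrite scale1r addr0 mul1r.
  by rewrite -{1}[ip 0 z]addr0 => /addrI <-.
have ipZ a u z : ip (a *: u) z = a * ip u z.
  by rewrite -[a *: u]addr0 ipL ip0 addr0.
have ipN u z : ip (- u) z = - ip u z by rewrite -scaleN1r ipZ mulN1r.
have ipB u v z : ip (u - v) z = ip u z - ip v z.
  by rewrite -[u]scale1r ipL ipN scale1r mul1r.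
have cs u : ip u y <= `|u| * `|y|.
  case: (eqVneq u 0) => [->|u0]; first by rewrite ip0 normr0 mul0r.
  case: (eqVneq y 0) => [->|y0]; first by rewrite ipC ip0 normr0 mulr0.
  have p : 0 < `|u| * `|y| by rewrite mulr_gt0 ?normr_gt0.
  (* This square is [2 * p * (p - ip u y)] with [p := `|u| * `|y|]. *)
  have : 0 <= ip (`|y| *: u - `|u| *: y) (`|y| *: u - `|u| *: y).
    by rewrite -ipE sqr_ge0.
  rewrite ipB !(ipC _ (_ - _)) !ipB !ipZ !(ipC _ (_ *: _)) !ipZ.
  rewrite (ipC y u) -!ipE => h.
  rewrite -subr_ge0 -(pmulr_rge0 _ p); nra.
pose ellM := GRing.isLinear.Build _ _ _ _ _ ipl.
pose ell : {linear Y -> R^o} := HB.pack (fun x => ip x y : R^o) ellM.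
exists ell; split; [|exact/esym/ipE|exact: cs].
apply: (@linear_norm_le_continuous _ _ _ _ `|y|) => x.
by rewrite mulrC ler_norml cs andbT lerNl -ipN (le_trans (cs _))// normrN.
Qed.

(** The mean value theorem fails for vector-valued maps, but it applies to the
inner product of [f] with the vector [y] to be estimated, and Cauchy-Schwarz
turns the resulting identity for [`|y| ^+ 2] into the bound. *)
Lemma hilbert_mean_value (X : normedModType R) (Y : completeNormedModType R)
    (hY : is_hilbert Y) (f : X -> Y) (a h : X) (w : Y) (k : R) :
  (forall t : R, 0 <= t <= 1 -> differentiable f (a + t *: h)) ->
  (forall t : R, 0 <= t <= 1 -> `|'d f (a + t *: h) h - w| <= k) ->
  `|f (a + h) - f a - w| <= k.
Proof.
move=> df dk; set y := f (a + h) - f a - w.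
have [ell [cell ely elle]] := hilbert_functional y hY.
pose phi (t : R) : R := ell (f (t *: h + a)).
have dphi (t : R) : 0 <= t <= 1 -> is_diff t (phi : R -> R)
    (fun s : R => ell ('d f (a + t *: h) (s *: h)) : R).
  move=> t01; have := df t t01; rewrite addrC => dft.
  have -> : phi = ell \o (f \o (fun s : R => s *: h + a)) by [].
  have -> : (fun s : R => ell ('d f (t *: h + a) (s *: h))) =
    ell \o ('d f (t *: h + a) \o (fun s : R => s *: h)) by [].
  apply: is_diff_comp; last first.
    apply: DiffDef; first exact: linear_differentiable.
    exact: diff_lin.
  apply: is_diff_comp.
    by apply: is_diff_eq; rewrite funeqE => s /=; rewrite addr0.
  exact: DiffDef.
have [||c c01] :=
  @MVT R phi (fun t : R => ell ('d f (a + t *: h) h) : R) 0 1 ltr01.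
- move=> t; rewrite in_itv/= => /andP[/ltW t0 /ltW t1].
  have /dphi dp : 0 <= t <= 1 by rewrite t0.
  apply: DeriveDef; first exact/diff_derivable.
  by rewrite deriveE// diff_val scale1r.
- apply: continuous_in_subspaceT => t; rewrite inE/= in_itv/= => /dphi dp.
  exact: differentiable_continuous.
move: c01; rewrite in_itv/= => /andP[/ltW c0 /ltW c1].
rewrite /phi scale1r scale0r add0r subr0 mulr1 => e.
have ey : `|y| ^+ 2 = ell ('d f (a + c *: h) h - w).
  by rewrite -ely /y [a + h]addrC linearB [in LHS]linearB e linearB.
have : `|y| ^+ 2 <= k * `|y|.
  rewrite ey (le_trans (elle _))// ler_wpM2r// dk// c0//.
have := normr_ge0 y; rewrite le_eqVlt => /predU1P[<- _|y0].
  by apply: le_trans (dk 0 _); rewrite ?lexx ?ler01.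
by rewrite expr2 ler_pM2r.
Qed.

End HilbertMeanValue.

(** * Stability of the perturbed linear operator *)

(** The lower bound of the linear part gives
[`|k| <= Num.sqrt (L / C1) * hnorm (L1 x, L2 x)], with a factor below 1, so the
triangle inequality keeps a positive fraction of that lower bound. *)
Lemma stability_bounds (R : realType) (U Sg H1 H2 : normedModType R)
    (L1 : {linear (U * Sg)%type -> H1}) (L2 : {linear (U * Sg)%type -> H2})
    (C1 C2 C3 C4 C5 C6 L : R) :
  [/\ 0 < C1, 0 < C2 & 0 < C3] /\ [/\ 0 < C4, 0 < C5 & 0 < C6] ->
  (forall u s,
    C1 * `|u| ^+ 2 + C2 * `|s| ^+ 2 <= `|L1 (u, s)| ^+ 2 + `|L2 (u, s)| ^+ 2) ->
  (forall u s, `|L1 (u, s)| ^+ 2 <= C3 * `|u| ^+ 2 + C4 * `|s| ^+ 2) ->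
  (forall u s, `|L2 (u, s)| ^+ 2 <= C5 * `|u| ^+ 2 + C6 * `|s| ^+ 2) ->
  0 < L < C1 ->
  exists c M : R, [/\ 0 < c, 0 < M & forall x k, `|k| <= Num.sqrt L * `|x.1| ->
    c * hnorm x <= hnorm (L1 x, L2 x + k) <= M * hnorm x].
Proof.
move=> [[C1p C2p C3p] [C4p C5p C6p]] lo up1 up2 /andP[L0 LC1].
pose q := Num.sqrt (L / C1); pose m := Num.min C1 C2.
pose B := C3 + C4 + C5 + C6.
have mp : 0 < m by rewrite lt_min C1p.
have Bp : 0 < B by rewrite !addr_gt0.
have q1 : q < 1.
  by rewrite -sqrtr1 ltr_sqrt// ltr_pdivrMr// mul1r.
have sqq : q ^+ 2 * C1 = L by rewrite sqr_sqrtr ?divr_ge0 ?ltW// divfK ?gt_eqF.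
have sql : Num.sqrt L ^+ 2 = L by rewrite sqr_sqrtr// ltW.
have sqm : Num.sqrt m ^+ 2 = m by rewrite sqr_sqrtr// ltW.
have sqB : Num.sqrt B ^+ 2 = B by rewrite sqr_sqrtr// ltW.
exists ((1 - q) * Num.sqrt m), (Num.sqrt B + Num.sqrt L); split.
- by rewrite mulr_gt0 ?sqrtr_gt0 ?subr_gt0.
- by rewrite addr_gt0 ?sqrtr_gt0.
move=> [u s] k /= hk.
have Eh : hnorm (u, s) ^+ 2 = `|u| ^+ 2 + `|s| ^+ 2 by rewrite sqr_hnorm.
set A := hnorm (L1 (u, s), L2 (u, s)).
have A0 : 0 <= A := hnorm_ge0 _.
have EA : A ^+ 2 = `|L1 (u, s)| ^+ 2 + `|L2 (u, s)| ^+ 2 by rewrite sqr_hnorm.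
have := lo u s; have := up1 u s; have := up2 u s; rewrite -EA.
have := sqr_ge0 `|u|; have := sqr_ge0 `|s|.
set a := `|u| ^+ 2 in Eh *; set b := `|s| ^+ 2 in Eh * => b0 a0 u2 u1 l1.
have le1 : Num.sqrt m * hnorm (u, s) <= A.
  rewrite -ler_sqr ?nnegrE ?mulr_ge0 ?sqrtr_ge0 ?hnorm_ge0//.
  rewrite exprMn sqm Eh; apply: le_trans l1.
  by rewrite mulrDr lerD// ler_wpM2r// /m ge_min lexx ?orbT.
have le2 : A <= Num.sqrt B * hnorm (u, s).
  rewrite -ler_sqr ?nnegrE ?mulr_ge0 ?sqrtr_ge0 ?hnorm_ge0//.
  rewrite exprMn sqB Eh EA; apply: le_trans (lerD u1 u2) _.
  by rewrite /B; nra.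
have le3 : Num.sqrt L * `|u| <= q * A.
  rewrite -ler_sqr ?nnegrE ?mulr_ge0 ?sqrtr_ge0//.
  rewrite exprMn sql -/a exprMn -sqq -mulrA ler_wpM2l ?sqr_ge0//.
  by apply: le_trans l1; rewrite lerDl mulr_ge0// ltW.
have split_k : (L1 (u, s), L2 (u, s) + k) = (L1 (u, s), L2 (u, s)) + (0, k).
  by rewrite /GRing.add/= /add_pair/= addr0.
have hA1 : hnorm (L1 (u, s), L2 (u, s) + k) <= A + `|k|.
  by rewrite split_k hnorm_inrD.
have hA2 : A <= hnorm (L1 (u, s), L2 (u, s) + k) + `|k|.
  by rewrite split_k hnorm_le_inrD.
have us : Num.sqrt L * `|u| <= Num.sqrt L * hnorm (u, s).
  by rewrite ler_wpM2l ?sqrtr_ge0// (norm_fst_hnorm (u, s)).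
apply/andP; split; last by rewrite mulrDl; lra.
rewrite -mulrA; apply: (@le_trans _ _ ((1 - q) * A)).
  by rewrite ler_wpM2l// subr_ge0 ltW.
by rewrite mulrBl mul1r; lra.
Qed.

(** * One inexact Newton step *)

Section LocalAnalysis.
Context {R : realType} {U Sg H1 H2 : completeNormedModType R}.
Context (L1 : {linear (U * Sg)%type -> H1}) (L2 : {linear (U * Sg)%type -> H2}).
Context (K : U -> H2) (b : H1 * H2) (S : set U) (l c M : R).
Context (c_gt0 : 0 < c) (M_gt0 : 0 < M) (l_ge0 : 0 <= l).
Context (stable : forall x k, `|k| <= l * `|x.1| ->
  c * hnorm x <= hnorm (L1 x, L2 x + k) <= M * hnorm x).
Context (S_open : open S).
Context (K_lip : forall u v, S u -> S v -> `|K u - K v| <= l * `|u - v|).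
Context (K_diff : forall u, S u -> differentiable K u).
Context (ustar : U * Sg) (S_ustar : S ustar.1).
Context (sol : calR L1 L2 K ustar + b = 0).

Local Notation G := (calR L1 L2 K).

Lemma stable0 x : hnorm (L1 x, L2 x) <= M * hnorm x.
Proof.
have := @stable x 0; rewrite normr0 addr0 mulr_ge0// => /(_ isT).
by case/andP.
Qed.

(** Continuity is what makes a linear map its own Frechet derivative. *)
Lemma L1_continuous : continuous L1.
Proof.
apply: (@linear_norm_le_continuous _ _ _ _ (M * 2)) => x.
apply: le_trans (norm_fst_hnorm (L1 x, L2 x)) _; apply: le_trans (stable0 x) _.
by rewrite -mulrA ler_pM2l// hnorm_le_norm.
Qed.

Lemma L2_continuous : continuous L2.
Proof.
apply: (@linear_norm_le_continuous _ _ _ _ (M * 2)) => x.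
apply: le_trans (norm_snd_hnorm (L1 x, L2 x)) _; apply: le_trans (stable0 x) _.
by rewrite -mulrA ler_pM2l// hnorm_le_norm.
Qed.

Lemma diff_calR (u v : U * Sg) : differentiable K u.1 ->
  'd G u v = (L1 v, L2 v + 'd K (u.1) v.1).
Proof.
move=> dK.
have fstl : linear (fst : U * Sg -> U) by [].
pose fstM := GRing.isLinear.Build _ _ _ _ _ fstl.
pose fstL : {linear (U * Sg)%type -> U} := HB.pack (fst : U * Sg -> U) fstM.
have cfst : continuous fstL.
  apply: (@linear_norm_le_continuous _ _ _ _ 1) => x.
  by rewrite mul1r prod_normE le_max lexx.
have dL1 : is_diff u L1 L1.
  apply: DiffDef; [apply: linear_differentiable|apply: diff_lin];
  exact: L1_continuous.
have dL2 : is_diff u L2 L2.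
  apply: DiffDef; [apply: linear_differentiable|apply: diff_lin];
  exact: L2_continuous.
have dfst : is_diff u fstL fstL.
  by apply: DiffDef; [apply: linear_differentiable|apply: diff_lin].
have dK' : is_diff (fstL u) K ('d K (u.1)) by exact: DiffDef.
have dKf : is_diff u (K \o fstL) ('d K (u.1) \o fstL) by exact: is_diff_comp.
have dsum : is_diff u (L2 \+ (K \o fstL)) (L2 \+ ('d K (u.1) \o fstL)).
  exact: is_diffD.
have dG : is_diff u (fun y => (L1 y, (L2 \+ (K \o fstL)) y))
   (fun y => (L1 y, (L2 \+ ('d K (u.1) \o fstL)) y)) by exact: is_diff_pair.
by rewrite -[G]/(fun y => (L1 y, (L2 \+ (K \o fstL)) y)) diff_val.
Qed.

Lemma diffK_bound u h : S u -> `|'d K u h| <= l * `|h|.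
Proof.
move=> Su; apply: differential_lipschitz_le; first exact: K_diff.
by have /open_nbhs_nbhs := conj S_open Su; apply: filterS => y Sy; exact: K_lip.
Qed.

Lemma residualE u :
  G u + b = (L1 (u - ustar), L2 (u - ustar) + (K u.1 - K ustar.1)).
Proof.
have -> : b = - G ustar by apply/eqP; rewrite -addr_eq0 addrC sol.
rewrite /calR [LHS]/GRing.add/= /add_pair/=.
by rewrite !linearB/= opprD addrACA.
Qed.

Lemma residual_bounds u : S u.1 ->
  c * hnorm (u - ustar) <= hnorm (G u + b) <= M * hnorm (u - ustar).
Proof. by move=> Su; rewrite residualE; apply: stable; exact: K_lip. Qed.

Lemma unique_solution u : S u.1 -> G u + b = 0 -> u = ustar.
Proof.
move=> Su Gu; have /andP[+ _] := residual_bounds Su.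
rewrite Gu hnorm0 pmulr_rle0// => /hnorm0_eq0 /eqP.
by rewrite subr_eq0 => /eqP.
Qed.

(** The Frechet derivative of [G] at any point with first component [u1]. *)
Definition derivative (u1 : U) (x : U * Sg) : H1 * H2 :=
  (L1 x, L2 x + 'd K u1 x.1).

Lemma derivative_bounds u1 x : S u1 ->
  c * hnorm x <= hnorm (derivative u1 x) <= M * hnorm x.
Proof. by move=> Su; apply: stable; exact: diffK_bound. Qed.

(** The linearization error of [K] seen from the iterate rather than from the
solution, since Newton's method uses the derivative at the iterate. *)
Definition defect (u1 : U) : H2 :=
  K u1 - K ustar.1 - 'd K u1 (u1 - ustar.1).

(** The linear parts of the residual are exact, so only [K] contributes an
error when the residual is linearized. *)
Lemma lin_residualE u v : S u.1 ->
  lin_residual G b u v = derivative u.1 (u + v - ustar) + (0, defect u.1).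
Proof.
move=> Su; rewrite /lin_residual diff_calR; last exact: K_diff.
rewrite -addrA [b + _]addrC residualE /derivative /defect.
have -> : u + v - ustar = v + (u - ustar) by rewrite [u + v]addrC addrA.
rewrite -[u.1 - ustar.1]/((u - ustar).1).
move: (u - ustar) => e; apply: injective_projections => /=.
  by rewrite addr0 linearD.
rewrite [L2 (_ + _)]linearD ['d K _ (v.1 + _)]linearD.
set t := 'd K _ e.1; set k := 'd K _ v.1; set D := K u.1 - _.
rewrite -[RHS]addrA [X in _ = _ + X](_ : _ = k + D); first exact: addrACA.
by rewrite -addrA [t + _]addrC subrK.
Qed.

Lemma derivative_step u v eta kappa : S u.1 -> 0 <= eta ->
  `|defect u.1| <= kappa * hnorm (u - ustar) -> accepted G b u eta v ->
  hnorm (derivative u.1 (u + v - ustar)) <=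
    eta * hnorm (G u + b) + kappa * hnorm (u - ustar).
Proof.
move=> Su eta0 du; rewrite /accepted lin_residualE// => acc.
by apply: le_trans (hnorm_le_inrD _ _) _; exact: lerD acc du.
Qed.

Lemma error_step u v eta kappa : S u.1 -> 0 <= eta ->
  `|defect u.1| <= kappa * hnorm (u - ustar) -> accepted G b u eta v ->
  c * hnorm (u + v - ustar) <= (eta * M + kappa) * hnorm (u - ustar).
Proof.
move=> Su eta0 du acc.
have /andP[h _] := derivative_bounds (u + v - ustar) Su.
apply: le_trans h _; apply: le_trans (derivative_step Su eta0 du acc) _.
rewrite mulrDl lerD2r -mulrA ler_wpM2l//.
by have /andP[] := residual_bounds Su.
Qed.

(** The two ways in which the derivative at [u1] must be accurate: for the
increment of [K] to [ustar], and against the derivative at [ustar]. *)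
Definition newton_close (kappa : R) (u1 : U) : Prop :=
  [/\ S u1, `|defect u1| <= kappa * `|u1 - ustar.1| &
      forall h, `|'d K u1 h - 'd K (ustar.1) h| <= kappa * `|h|].

(** A norm equivalent to [hnorm] in which one step contracts by almost [eta],
without the condition number [M / c]. *)
Definition energy (x : U * Sg) : R := hnorm (derivative ustar.1 x).

Lemma near_newton_close kappa : diff_continuous_at K ustar.1 -> 0 < kappa ->
  \forall u1 \near ustar.1, newton_close kappa u1.
Proof.
move=> dKc kap0; have k2 : 0 < kappa / 2 by rewrite divr_gt0.
have /open_nbhs_nbhs Sn := conj S_open S_ustar.
have hK := near_diff_approx (K_diff S_ustar) k2; have hd := dKc _ k2.
near=> u1.
have Su : S u1 by near: u1.
have h1 : `|K u1 - K ustar.1 - 'd K (ustar.1) (u1 - ustar.1)| <=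
    kappa / 2 * `|u1 - ustar.1| by near: u1.
have h2 : forall h, `|'d K u1 h - 'd K (ustar.1) h| <= kappa / 2 * `|h|.
  by near: u1.
split => // [|h]; last first.
  by apply: le_trans (h2 h) _; rewrite ler_wpM2r//; lra.
rewrite /defect; set h := u1 - ustar.1.
have -> : K u1 - K ustar.1 - 'd K u1 h =
  (K u1 - K ustar.1 - 'd K (ustar.1) h) - ('d K u1 h - 'd K (ustar.1) h).
  by rewrite opprB addrA subrK.
by rewrite [kappa]splitr mulrDl (le_trans (ler_normB _ _))// lerD.
Unshelve. all: by end_near. Qed.

(** Freezing the derivative at [ustar] costs [kappa] times the error three times:
twice in bounding the residual by the energy, and once for the defect. It costs
[kappa] times the new error once more, where the new error is at most
[(M + 1) / c] times the old one. Together these are at most [(1 - tau) / 2]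
times the energy. *)
Lemma energy_step u v eta tau kappa : newton_close kappa u.1 ->
  0 <= eta <= tau -> tau < 1 -> 0 <= kappa <= 1 ->
  kappa * (3 + (M + 1) / c) <= (1 - tau) / 2 * c ->
  accepted G b u eta v ->
  energy (u + v - ustar) <= (1 + tau) / 2 * energy (u - ustar).
Proof.
move=> [Su du dd] /andP[eta0 etat] tau1 /andP[kap0 kap1] kapsmall acc.
have e1 : `|(u - ustar).1| <= hnorm (u - ustar) := norm_fst_hnorm _.
have du' : `|defect u.1| <= kappa * hnorm (u - ustar).
  by apply: le_trans du _; rewrite ler_wpM2l.
have ns := derivative_step Su eta0 du' acc.
have es := error_step Su eta0 du' acc.
have /andP[lowe _] := derivative_bounds (u - ustar) S_ustar.
have he0 := hnorm_ge0 (u - ustar).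
set e := hnorm (u - ustar) in e1 du' ns es lowe he0 *.
have res : hnorm (G u + b) <= energy (u - ustar) + 2 * kappa * e.
  rewrite residualE.
  have -> : (L1 (u - ustar), L2 (u - ustar) + (K u.1 - K ustar.1)) =
    derivative ustar.1 (u - ustar) +
    (0, K u.1 - K ustar.1 - 'd K (ustar.1) (u - ustar).1).
    apply: injective_projections => /=; first by rewrite addr0.
    by rewrite -[RHS]addrA [X in _ = _ + X]addrC subrK.
  apply: le_trans (hnorm_inrD _ _) _; rewrite lerD2l.
  have -> : K u.1 - K ustar.1 - 'd K (ustar.1) (u - ustar).1 =
    defect u.1 + ('d K (u.1) (u - ustar).1 - 'd K (ustar.1) (u - ustar).1).
    by rewrite /defect addrA subrK.
  apply: le_trans (ler_normD _ _) _.
  have := dd (u - ustar).1; nra.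
set e' := u + v - ustar in ns es *.
have e'0 := hnorm_ge0 e'.
have en' : energy e' <= hnorm (derivative u.1 e') + kappa * hnorm e'.
  rewrite /energy.
  have -> : derivative ustar.1 e' = derivative u.1 e' +
    (0, 'd K (ustar.1) e'.1 - 'd K (u.1) e'.1).
    apply: injective_projections => /=; first by rewrite addr0.
    by rewrite -[RHS]addrA [X in _ = _ + X]addrC subrK.
  apply: le_trans (hnorm_inrD _ _) _; rewrite lerD2l distrC.
  by apply: le_trans (dd _) _; rewrite ler_wpM2l// norm_fst_hnorm.
have E0 : 0 <= energy (u - ustar) := hnorm_ge0 _.
have he' : hnorm e' <= (M + 1) / c * e.
  rewrite -(ler_pM2l c_gt0) (le_trans es)// mulrA [c * _]mulrC divfK ?gt_eqF//.
  rewrite ler_wpM2r//.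
  have : eta * M <= 1 * M.
    by apply: ler_wpM2r; [exact: ltW|exact: le_trans etat (ltW tau1)].
  by lra.
have lowe' : c * e <= energy (u - ustar) by exact: lowe.
have h1 : eta * hnorm (G u + b) <= tau * energy (u - ustar) + 2 * kappa * e.
  apply: (@le_trans _ _ (eta * (energy (u - ustar) + 2 * kappa * e))).
    by rewrite ler_wpM2l.
  rewrite mulrDr lerD ?ler_wpM2r// ler_piMl ?mulr_ge0//; lra.
have h2 : kappa * hnorm e' <= kappa * ((M + 1) / c * e) by rewrite ler_wpM2l.
have h3 : kappa * (3 + (M + 1) / c) * e <= (1 - tau) / 2 * energy (u - ustar).
  apply: (@le_trans _ _ ((1 - tau) / 2 * c * e)); first by rewrite ler_wpM2r.
  by rewrite -mulrA ler_wpM2l// divr_ge0// subr_ge0 ltW.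
move: h1 h2 h3 ns en'; rewrite -/e.
set w := (M + 1) / c; nra.
Qed.

Lemma afem_loop_accepted (d : nat) (Omega : set 'rV[R]_d)
    (F : fe_setting Omega U Sg H1 H2) (theta : R)
    (A : afem_choices G b F theta) u eta T du T' :
  afem_loop A u eta T du T' -> accepted G b u eta du.
Proof. by elim. Qed.

(** By the mean value inequality the defect is bounded by the variation of the
derivative of [K] along the segment from [ustar] to [u], times its length; on
this segment the variation is at most the Lipschitz constant times the length. *)
Lemma defect_quadratic (hH2 : is_hilbert H2) (r : R) :
  (forall v : U * Sg, hball ustar r v -> S v.1) ->
  diff_lipschitz_on K (hball ustar r) ->
  exists2 k : R, 0 <= k & forall u, hball ustar r u ->
    `|defect u.1| <= k * hnorm (u - ustar) * hnorm (u - ustar).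
Proof.
move=> rS [k klip]; exists `|k| => // u ru.
set h := u.1 - ustar.1.
have hle : `|h| <= hnorm (u - ustar) := norm_fst_hnorm (u - ustar).
have eh : ustar.1 + h = u.1 by rewrite addrC subrK.
have seg (t : R) : 0 <= t <= 1 -> hball ustar r (ustar.1 + t *: h, ustar.2).
  (* The second component stays at that of [ustar]: the ball of the Lipschitz
     hypothesis is in the product, and this keeps the points within it. *)
  move=> /andP[t0 t1]; apply: le_lt_trans ru.
  have -> : (ustar.1 + t *: h, ustar.2) - ustar = (t *: h, 0).
    by apply: injective_projections => /=; rewrite ?subrr// addrC addKr.
  apply: hnorm_le; first exact: hnorm_ge0.
  rewrite /= normr0 expr0n addr0 ler_sqr ?nnegrE ?hnorm_ge0//.
  by rewrite normrZ ger0_norm// (le_trans _ hle)// ler_piMl.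
apply: (@le_trans _ _ (`|k| * `|h| * `|h|)); last first.
  by rewrite -!mulrA ler_wpM2l// ler_pM.
have -> : defect u.1 = K (ustar.1 + h) - K ustar.1 - 'd K (u.1) h.
  by rewrite eh.
apply: hilbert_mean_value => // t t01; first exact/K_diff/(rS _ (seg t t01)).
have := klip _ _ (seg t t01) ru h => /=; move/le_trans; apply.
have -> : ustar.1 + t *: h - u.1 = (t - 1) *: h.
  by rewrite -{1}eh opprD addrACA subrr add0r scalerBl scale1r.
rewrite normrZ -!mulrA; case/andP: t01 => t0 t1.
apply: (@le_trans _ _ (`|k| * (`|t - 1| * (`|h| * `|h|)))).
  by rewrite ler_wpM2r ?ler_norm// !mulr_ge0.
rewrite ler_wpM2l// ler_piMl ?mulr_ge0// ler_norml; lra.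
Qed.

(** * The iterates *)

Section Sequence.
Context (d : nat) (Omega : set 'rV[R]_d) (F : fe_setting Omega U Sg H1 H2).
Context (tau theta : R) (tau01 : 0 < tau < 1).
Context (A : afem_choices G b F theta) (T0 : mesh F).
Context (kappa r : R) (kappa01 : 0 <= kappa <= 1).
Context (kappa_small : kappa * (3 + (M + 1) / c) <= (1 - tau) / 2 * c).
Context (close : forall u1, `|u1 - ustar.1| < r -> newton_close kappa u1).

Let q := (1 + tau) / 2.

(** An energy ball, since only the energy is known to decrease at each step; the
radius [c * r] makes it a part of the [hnorm] ball of radius [r]. *)
Definition basin : set (U * Sg) := [set u | energy (u - ustar) < c * r].

Lemma error_le_energy u : c * hnorm (u - ustar) <= energy (u - ustar).
Proof. by have /andP[] := derivative_bounds (u - ustar) S_ustar. Qed.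

Lemma energy_le_error u : energy (u - ustar) <= M * hnorm (u - ustar).
Proof. by have /andP[] := derivative_bounds (u - ustar) S_ustar. Qed.

Lemma basin_close u : basin u -> newton_close kappa u.1.
Proof.
move=> Bu; apply: close.
apply: le_lt_trans (norm_fst_hnorm (u - ustar)) _.
by rewrite -(ltr_pM2l c_gt0); exact: le_lt_trans (error_le_energy u) Bu.
Qed.

Lemma basin_S u : basin u -> S u.1.
Proof. by case/basin_close. Qed.

Lemma basin_step u v eta : basin u -> 0 <= eta <= tau ->
  accepted G b u eta v ->
  energy (u + v - ustar) <= q * energy (u - ustar) /\ basin (u + v).
Proof.
move=> Bu eta01 acc; case/andP: tau01 => tau0 tau1.
have h := energy_step (basin_close Bu) eta01 tau1 kappa01 kappa_small acc.
split=> //; apply: le_lt_trans Bu; apply: le_trans h _.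
by rewrite ler_piMl ?hnorm_ge0//; lra.
Qed.

Lemma next_eta_bounds eta u : 0 <= eta <= tau ->
  0 <= next_eta G b tau eta u <= tau.
Proof.
case/andP: tau01 => tau0 tau1 /andP[eta0 etat].
rewrite /next_eta le_min hnorm_ge0 andbT mulr_ge0 ?(ltW tau0)//=.
rewrite ge_min (le_trans (_ : tau * eta <= tau))//.
by rewrite ler_piMr ?(ltW tau0)// (le_trans etat) ?ltW.
Qed.

(** Dependent choice over the states (iterate, forcing parameter, mesh) that the
algorithm reaches inside the basin. Reachability belongs to the state because
termination of the loop is known only for calls made by the algorithm. *)
Lemma gn_sequence_exists u0 :
  afem_converges A tau T0 [set u | S u.1] -> basin u0 ->
  exists u, gn_sequence A tau T0 u0 u.
Proof.
move=> conv Bu0; case/andP: (tau01) => tau0 tau1.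
pose st : Type := (U * Sg) * R * mesh F.
pose inv (p : st) := [/\ gn_call A tau T0 u0 p.1.1 p.1.2 p.2,
  basin p.1.1 & 0 <= p.1.2 <= tau].
pose step (p p' : {p : st | inv p}) := exists du,
  [/\ afem_loop A (sval p).1.1 (sval p).1.2 (sval p).2 du (sval p').2,
      (sval p').1.1 = (sval p).1.1 + du &
      (sval p').1.2 = next_eta G b tau (sval p).1.2 (sval p').1.1].
have inv0 : inv (u0, tau, T0).
  by split => //=; [exact: GNStart|rewrite lexx ltW].
have next (p : {p : st | inv p}) : {p' | step p p'}.
  apply: cid; case: p => -[[u eta] T] [/= call Bu eta01].
  have [du [T' loop]] := conv _ (basin_S Bu0) _ _ _ call (basin_S Bu).
  have inv' : inv (u + du, next_eta G b tau eta (u + du), T').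
    split => /=; first exact: GNNext call loop.
      by have [] := basin_step Bu eta01 (afem_loop_accepted loop).
    exact: next_eta_bounds.
  by exists (exist _ _ inv'), du; split.
have [s [s0 ss]] := dependent_choice next (exist _ _ inv0).
have [du dus] := choice ss.
exists (fun n => (sval (s n)).1.1), (fun n => (sval (s n)).1.2),
  (fun n => (sval (s n)).2), du.
by split; rewrite ?s0// => n; have [] := dus n.
Qed.

Section Iterates.
Context (eta : nat -> R) (T : nat -> mesh F) (u du : nat -> U * Sg).
Context (Bu0 : basin (u 0%N)) (eta0 : eta 0%N = tau).
Context (steps : forall n, [/\ afem_loop A (u n) (eta n) (T n) (du n) (T n.+1),
  u n.+1 = u n + du n & eta n.+1 = next_eta G b tau (eta n) (u n.+1)]).

Let err n := hnorm (u n - ustar).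

Lemma iterates_basin n : basin (u n) /\ 0 <= eta n <= tau.
Proof.
case/andP: (tau01) => tau0 tau1.
elim: n => [|n [Bu eta01]]; first by rewrite eta0 lexx ltW.
have [/afem_loop_accepted acc uS etaS] := steps n.
split; first by rewrite uS; have [] := basin_step Bu eta01 acc.
by rewrite etaS; exact: next_eta_bounds.
Qed.

Lemma err_step n k : `|defect (u n).1| <= k * err n ->
  c * err n.+1 <= (eta n * M + k) * err n.
Proof.
move=> dk; have [Bu /andP[en _]] := iterates_basin n.
have [/afem_loop_accepted acc uS _] := steps n.
by rewrite /err uS; exact: error_step (basin_S Bu) en dk acc.
Qed.

Lemma iterates_S n : S (u n).1.
Proof. by apply: basin_S; have [] := iterates_basin n. Qed.

Lemma iterates_cvg : u @ \oo --> ustar.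
Proof.
case/andP: (tau01) => tau0 tau1.
have q0 : 0 <= q by rewrite /q; lra.
have q1 : q < 1 by rewrite /q; lra.
have en n : energy (u n - ustar) <= q ^+ n * energy (u 0%N - ustar).
  elim: n => [|n ih]; first by rewrite expr0 mul1r.
  have [Bu eta01] := iterates_basin n.
  have [/afem_loop_accepted acc uS _] := steps n.
  rewrite uS; have [h _] := basin_step Bu eta01 acc.
  by apply: le_trans h _; rewrite exprS -mulrA ler_wpM2l.
apply/cvg_hnormP; apply: (@squeeze_cvgr _ _ _ _ (fun=> 0)
  (fun n => q ^+ n * (c^-1 * energy (u 0%N - ustar)))).
- near=> n; rewrite hnorm_ge0/= mulrCA -(ler_pM2l c_gt0) mulVKf ?gt_eqF//.
  exact: le_trans (error_le_energy _) (en n).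
- exact: cvg_cst.
- rewrite -[X in _ --> X](mul0r (c^-1 * energy (u 0%N - ustar))).
  by apply: cvgMl; apply: cvg_expr; rewrite ger0_norm.
Unshelve. all: by end_near. Qed.

Lemma err_cvg0 : err @ \oo --> (0 : R).
Proof. exact/cvg_hnormP/iterates_cvg. Qed.

Lemma eta_cvg0 : eta @ \oo --> (0 : R).
Proof.
case/andP: (tau01) => tau0 tau1.
apply: (@squeeze_cvgr _ _ _ _ (fun=> 0) (fun n => tau ^+ n)).
- near=> n; have [_ /andP[-> _]] /= := iterates_basin n.
  elim: (n) => [|m ih]; first by rewrite eta0 expr0 ltW.
  have [_ _ ->] := steps m; rewrite /next_eta ge_min exprS.
  by rewrite (ler_wpM2l (ltW tau0) ih).
- exact: cvg_cst.
- by apply: cvg_expr; rewrite ger0_norm ?ltW.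
Unshelve. all: by end_near. Qed.

(** Both [eta n * M] and [kappa] are eventually below half of any prescribed
[c * e], which suffices by [err_step]. *)
Lemma iterates_superlinear :
  diff_continuous_at K ustar.1 -> superlinear_cvg u ustar.
Proof.
move=> Kc; split; first exact: iterates_cvg.
apply/eqoP => e e0.
have k0 : 0 < c * e / 2 by rewrite !(mulr_gt0, divr_gt0).
have nc := near_newton_close Kc k0.
have ufst : (fun n => (u n).1) @ \oo --> ustar.1.
  exact: (cvg_comp _ _ iterates_cvg cvg_fst).
have nc' := ufst _ nc.
have ne : \forall n \near \oo, eta n * M <= c * e / 2.
  have m0 : 0 < c * e / 2 / M by rewrite divr_gt0.
  have := eta_cvg0; move/cvgr0Pnorm_lt => /(_ _ m0).
  apply: filterS => n; rewrite -(ler_pdivlMr _ _ M_gt0) => h.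
  by apply: le_trans (ler_norm _) (ltW h).
near=> n.
rewrite !ger0_norm ?hnorm_ge0//.
have [Su dk _] : newton_close (c * e / 2) (u n).1 by near: n.
have he : eta n * M <= c * e / 2 by near: n.
have dk' : `|defect (u n).1| <= c * e / 2 * err n.
  apply: le_trans dk _; rewrite (ler_wpM2l (ltW k0))//.
  exact: (norm_fst_hnorm (u n - ustar)).
rewrite -/(err n) -/(err n.+1) -(ler_pM2l c_gt0).
apply: le_trans (err_step dk') _; rewrite mulrA ler_wpM2r ?hnorm_ge0//; lra.
Unshelve. all: by end_near. Qed.

Lemma iterates_quadratic (hH2 : is_hilbert H2) (eps : R) : 0 < eps ->
  (forall v : U * Sg, hball ustar eps v -> S v.1) ->
  diff_lipschitz_on K (hball ustar eps) -> quadratic_cvg u ustar.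
Proof.
move=> eps0 epsS Klip; split; first exact: iterates_cvg.
have [k k0 kP] := defect_quadratic hH2 epsS Klip.
apply/eqO_exP; exists ((M * M + k) / c).
  by rewrite divr_gt0// ltr_wpDr// mulr_gt0.
have ne : \forall n \near \oo, err n < eps.
  have := err_cvg0; move/cvgr0Pnorm_lt => /(_ _ eps0).
  by apply: filterS => n; rewrite ger0_norm ?hnorm_ge0.
near=> n.
rewrite !ger0_norm ?sqr_ge0 ?hnorm_ge0//.
have h1 := kP (u n) (_ : err n < eps).
have {h1} /err_step h1 : `|defect (u n).1| <= k * err n * err n.
  by apply: h1; near: n.
have heta : eta n <= M * err n.
  (* The initial forcing parameter is [tau], unrelated to the residual. *)
  have n0 : (0 < n)%N by near: n; exact: nbhs_infty_gt.
  have [_ _] := steps n.-1; rewrite (prednK n0) => ->.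
  rewrite /next_eta ge_min; apply/orP; right.
  have [Bu _] := iterates_basin n.
  by have /andP[] := residual_bounds (basin_S Bu).
rewrite -(ler_pM2l c_gt0) mulrA [c * (_ / _)]mulrC divfK ?gt_eqF//.
apply: le_trans h1 _; rewrite expr2 mulrA ler_wpM2r ?hnorm_ge0//.
rewrite mulrDl lerD2r [leRHS]mulrAC ler_wpM2r// ?ltW//.
Unshelve. all: by end_near. Qed.

End Iterates.
End Sequence.
End LocalAnalysis.

(** * The convergence theorem *)

Theorem theorem3p2 (R : realType) (U Sg H1 H2 : completeNormedModType R)
    (hU : is_hilbert U) (hSg : is_hilbert Sg)
    (hH1 : is_hilbert H1) (hH2 : is_hilbert H2)
    (L1 : {linear (U * Sg)%type -> H1}) (L2 : {linear (U * Sg)%type -> H2})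
    (K : U -> H2) (f : H1) (g : H2)
    (C1 C2 C3 C4 C5 C6 : R)
    (hC : [/\ 0 < C1, 0 < C2 & 0 < C3] /\ [/\ 0 < C4, 0 < C5 & 0 < C6])
    (A1_lower : forall (u : U) (s : Sg),
      C1 * `|u| ^+ 2 + C2 * `|s| ^+ 2 <= `|L1 (u, s)| ^+ 2 + `|L2 (u, s)| ^+ 2)
    (A1_upper1 : forall (u : U) (s : Sg),
      `|L1 (u, s)| ^+ 2 <= C3 * `|u| ^+ 2 + C4 * `|s| ^+ 2)
    (A1_upper2 : forall (u : U) (s : Sg),
      `|L2 (u, s)| ^+ 2 <= C5 * `|u| ^+ 2 + C6 * `|s| ^+ 2)
    (S : set U) (S_open : open S) (S_nonempty : S !=set0)
    (L : R) (hL : 0 < L < C1)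
    (A2 : forall u v, S u -> S v -> `|K u - K v| ^+ 2 <= L * `|u - v| ^+ 2)
    (ustar : U * Sg) (hS : S ustar.1)
    (hsol : calR L1 L2 K ustar + (f, g) = 0)
    (K_diff : forall u, S u -> differentiable K u)
    (* Frechet differentiability at the points of S does not suffice for the
       convergence of Newton's method: see K u = c * u^2 * sin (1 / u) on the
       real line, with 1/2 < c < 1. Continuity at ustar is assumed moreover. *)
    (K_diff_cont : diff_continuous_at K ustar.1)
    (d : nat) (Omega : set 'rV[R]_d) (F : fe_setting Omega U Sg H1 H2)
    (tau theta : R) (htau : 0 < tau < 1) (htheta : 0 < theta < 1)
    (A : afem_choices (calR L1 L2 K) (f, g) F theta) (T0 : mesh F)
    (hafem : afem_converges A tau T0 [set u | S u.1]) :
  exists2 eps : R, 0 < eps & forall u0, hball ustar eps u0 ->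
    [/\
        (exists u, gn_sequence A tau T0 u0 u) /\
        (forall u, gn_sequence A tau T0 u0 u ->
           (forall n, S (u n).1) /\ u @ \oo --> ustar),
        hball ustar eps ustar /\
        (forall v, hball ustar eps v ->
           calR L1 L2 K v + (f, g) = 0 -> v = ustar),
        (forall u, gn_sequence A tau T0 u0 u -> superlinear_cvg u ustar) &
        (diff_lipschitz_on K (hball ustar eps) ->
         forall u, gn_sequence A tau T0 u0 u -> quadratic_cvg u ustar)].
Proof.
have [c [M [c0 M0 stable]]] :=
  stability_bounds hC A1_lower A1_upper1 A1_upper2 hL.
have l0 : 0 <= Num.sqrt L := sqrtr_ge0 L.
have Klip u v : S u -> S v -> `|K u - K v| <= Num.sqrt L * `|u - v|.
  move=> Su Sv; rewrite -ler_sqr ?nnegrE ?mulr_ge0//.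
  by rewrite exprMn sqr_sqrtr ?A2//; case/andP: hL => /ltW.
have [tau0 tau1] := andP htau.
pose w := 3 + (M + 1) / c.
have w0 : 0 < w by rewrite addr_gt0// divr_gt0// addr_gt0.
(* The largest [kappa] admitted by [energy_step]. *)
pose kappa := Num.min 1 ((1 - tau) / 2 * c / w).
have p0 : 0 < (1 - tau) / 2 * c by rewrite mulr_gt0// divr_gt0// subr_gt0.
have kap0 : 0 < kappa by rewrite lt_min ltr01/= divr_gt0.
have kap01 : 0 <= kappa <= 1 by rewrite ltW//= ge_min lexx.
have kaps : kappa * w <= (1 - tau) / 2 * c.
  by rewrite -ler_pdivlMr// ge_min lexx orbT.
have /nbhs_normP[r /= r0 close] :=
  near_newton_close S_open K_diff hS K_diff_cont kap0.
have {}close u1 : `|u1 - ustar.1| < r -> newton_close K S ustar kappa u1.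
  by rewrite distrC => /close.
(* The first bound keeps the ball inside the region of [close], where uniqueness
   holds; the second one puts it inside the basin. *)
pose eps := Num.min r (c * r / M).
have eps0 : 0 < eps by rewrite lt_min r0 divr_gt0// mulr_gt0.
have epsS (v : U * Sg) : hball ustar eps v -> S v.1.
  move=> Bv; have [] // := close v.1.
  apply: le_lt_trans (norm_fst_hnorm (v - ustar)) _.
  by apply: lt_le_trans Bv _; rewrite ge_min lexx.
have epsB u0 : hball ustar eps u0 -> basin L1 L2 K c ustar r u0.
  move=> Bu; rewrite /basin/=.
  apply: le_lt_trans (energy_le_error stable S_open Klip K_diff hS u0) _.
  rewrite mulrC -ltr_pdivlMr//; apply: lt_le_trans Bu _.
  by rewrite ge_min lexx orbT.
exists eps => // u0 Bu0; have Bu := epsB _ Bu0; split.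
- split.
    exact: (gn_sequence_exists c0 M0 l0 stable S_open Klip K_diff hS hsol
      htau kap01 kaps close hafem Bu).
  move=> u [eta [T [du [u0E eta0 _ steps]]]]; rewrite -u0E in Bu; split.
    exact: (iterates_S c0 M0 l0 stable S_open Klip K_diff hS hsol
      htau kap01 kaps close Bu eta0 steps).
  exact: (iterates_cvg c0 M0 l0 stable S_open Klip K_diff hS hsol
    htau kap01 kaps close Bu eta0 steps).
- split; first by rewrite /hball/= subrr hnorm0.
  by move=> v /epsS Sv; exact: (unique_solution c0 stable Klip hS hsol).
- move=> u [eta [T [du [u0E eta0 _ steps]]]]; rewrite -u0E in Bu.
  exact: (iterates_superlinear c0 M0 l0 stable S_open Klip K_diff hS hsol
    htau kap01 kaps close Bu eta0 steps).
- move=> Klip' u [eta [T [du [u0E eta0 _ steps]]]]; rewrite -u0E in Bu.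
  exact: (iterates_quadratic c0 M0 l0 stable S_open Klip K_diff hS hsol
    htau kap01 kaps close Bu eta0 steps hH2 eps0 epsS Klip').
Qed.
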